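(* Let $k\ge 2$ and $s\ge 2$ be integers, let $X=C_{2k+1}\circ\overline{K_s}$, where $V(C_{2k+1})=\{v_1,\dots,v_{2k+1}\}$ (in the natural cyclic order) and $V(\overline{K_s})=\{w_1,\dots,w_s\}$, and let $X_f$ be the orientation of $X$ whose arcs are $$\big((v_i,w_j),(v_{i+1},w_\ell)\big)\quad\text{for all } i\in\{1,\dots,2k\},\ j,\ell\in\{1,\dots,s\},$$ and $$\big((v_1,w_j),(v_{2k+1},w_\ell)\big)\quad\text{for all } j,\ell\in\{1,\dots,s\}.$$ Then $$\gamma(X_f)=s+2k-2\qquad\text{and}\qquad \rho(X_f)=s+k-1.$$
   Context: $C_{m}$ is the cycle of order $m$ and $\overline{K_s}$ is the edgeless graph on $s$ vertices. The lexicographic product $G\circ H$ has vertex set $V(G)\times V(H)$, and $(x,y)$, $(u,v)$ are adjacent if either $xu\in E(G)$, or $x=u$ and $yv\in E(H)$. In a digraph $D$ with vertex set $V(D)$ and arc set $A(D)$, a vertex $u$ dominates $v$ if $(u,v)\in A(D)$; a set $S\subseteq V(D)$ is a dominating set if every vertex of $V(D)\setminus S$ is dominated by some vertex of $S$; $\gamma(D)$ is the smallest cardinality of a dominating set of $D$. A set $P\subseteq V(D)$ is a packing of $D$ if there are no arcs joining vertices of $P$ and for every two distinct vertices $x,y\in P$ there is no $v\in V(D)$ with $\{(v,x),(v,y)\}\subseteq A(D)$. The packing number $\rho(D)$ is the cardinality of a largest packing in $D$. *)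

(* Defs.v *)
From mathcomp Require Import all_boot.

Set Implicit Arguments.
Unset Strict Implicit.
Unset Printing Implicit Defensive.

(* A finite graph (resp. digraph) on V is given by its adjacency relation
   (resp. by its arc relation, [D u v] meaning that (u, v) is an arc). *)

(* This is the usual simple cycle when 3 <= m. *)
Definition cycle_graph (m : nat) : rel 'I_m :=
  fun i j => (j == ordS i) || (i == ordS j).

Definition edgeless_graph (s : nat) : rel 'I_s := fun _ _ => false.

Definition lex_product (V W : finType) (G : rel V) (H : rel W) : rel (V * W) :=
  fun p q => G p.1 q.1 || (p.1 == q.1) && H p.2 q.2.

Record orientation (V : finType) (G : rel V) := Orientation {
  arc :> rel V;
  arc_edge : forall u v, G u v = arc u v || arc v u;
  arc_asym : forall u v, ~~ (arc u v && arc v u)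
}.

Definition dominating (V : finType) (D : rel V) (S : {set V}) : bool :=
  [forall v, (v \notin S) ==> [exists u in S, D u v]].

(* [setT] is always dominating, so this is a genuine minimum. *)
Definition domination_number (V : finType) (D : rel V) : nat :=
  #|[arg min_(S < [set: V] | dominating D S) #|S|]|.

Definition packing (V : finType) (D : rel V) (P : {set V}) : bool :=
  [forall x in P, forall y in P,
     ~~ D x y && ((x != y) ==> ~~ [exists v, D v x && D v y])].

Definition packing_number (V : finType) (D : rel V) : nat :=
  \max_(P : {set V} | packing D P) #|P|.

Definition X (k s : nat) : rel ('I_(2 * k).+1 * 'I_s) :=
  lex_product (@cycle_graph (2 * k).+1) (@edgeless_graph s).

(* Indices are shifted by one: the ordinal i stands for v_(i+1), so v_1 is 0
   and v_(2k+1) is 2k. *)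
Definition Xf_arc (k s : nat) : rel ('I_(2 * k).+1 * 'I_s) :=
  fun p q => (q.1 == p.1.+1 :> nat)
          || (p.1 == 0 :> nat) && (q.1 == 2 * k :> nat).

Lemma Xf_arc_edge (k s : nat) (hk : 2 <= k) (p q : 'I_(2 * k).+1 * 'I_s) :
  X p q = Xf_arc p q || Xf_arc q p.
Proof.
case: p q => [i a] [j b].
rewrite /X /lex_product /edgeless_graph /cycle_graph /Xf_arc /= andbF orbF.
have succE (x y : 'I_(2 * k).+1) : (y == ordS x) =
    (y == x.+1 :> nat) || (y == 0 :> nat) && (x == 2 * k :> nat).
  rewrite -val_eqE /=; have := ltn_ord x; rewrite ltnS leq_eqVlt.
  case/orP => [/eqP ->|ltx].
    rewrite modnn eqxx andbT; have := ltn_ord y.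
    by case: (eqVneq (y : nat) (2 * k).+1) => [->|_]; rewrite ?ltnn ?orbF.
  by rewrite modn_small ?ltnS // (ltn_eqF ltx) andbF orbF.
rewrite !succE andbC [(i == 0 :> nat) && _]andbC.
by case: (_ == _.+1 :> nat); case: (_ == _.+1 :> nat);
   case: (_ && _); case: (_ && _).
Qed.

Lemma Xf_arc_asym (k s : nat) (hk : 2 <= k) (p q : 'I_(2 * k).+1 * 'I_s) :
  ~~ (Xf_arc p q && Xf_arc q p).
Proof.
case: p q => [i a] [j b]; rewrite /Xf_arc /=.
have k2 : 3 < 2 * k by rewrite (leq_trans _ (leq_mul (leqnn 2) hk)).
apply/negP => /andP[/orP[/eqP e1|/andP[/eqP e1 /eqP e2]]
                    /orP[/eqP e3|/andP[/eqP e3 /eqP e4]]].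
- by move: (ltnn i); rewrite {2}e3 e1 ltnS leqnSn.
- by rewrite e3 in e1.
- by rewrite e1 e2 in e3.
- by rewrite -e2 e3 in k2.
Qed.

Definition Xf (k s : nat) (hk : 2 <= k) : orientation (@X k s) :=
  Orientation (Xf_arc_edge hk) (Xf_arc_asym hk).

(* Main.v *)
Require Import Defs.
From mathcomp Require Import all_boot zify.

(** Write L_i for the copy of the edgeless graph over the i-th vertex of the
    cycle, 0 <= i <= 2k.  In the orientation, L_i dominates L_(i+1) completely,
    and L_0 also dominates L_(2k); no arc enters L_0.  Both parameters therefore
    depend only on the layer sizes a_i of a set, through
    #|S| = a_0 + ... + a_(2k).

    Domination.  A dominating set contains the source layer L_0, which takes
    care of L_1 and L_(2k).  Each of the 2k - 2 layers L_2, ..., L_(2k-1) is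
    dominated from the preceding layer only, so a_(i-1) = 0 forces
    a_i = s >= 2: skipping a layer is paid back by the next one, and
    a_1 + ... + a_(2k-1) >= 2k - 2 ([leq_sum_skip]).  Equality holds for L_0 with
    one vertex in each of L_1, ..., L_(2k-2).

    Packing.  Above L_0, two vertices of the same layer have a common
    in-neighbour, and vertices of consecutive layers are joined, so a packing
    has at most one vertex in L_i and L_(i+1) together ([packing_layers2]).
    If it meets L_0, then L_1 and L_(2k) are excluded, and the other layers pair
    up as (2, 3), ..., (2k-2, 2k-1), which gives at most s + (k - 1).  If it
    misses L_0, the pairs (1, 2), ..., (2k-1, 2k) give at most k <= s + k - 1.
    Equality holds for L_0 with one vertex in each of
    L_2, L_4, ..., L_(2k-2). *)

Set Implicit Arguments.
Unset Strict Implicit.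
Unset Printing Implicit Defensive.

(** * Sums of natural numbers *)

(** The summand [a m == 0] is a debt: an empty last position may leave the sum
    one short, which is compensated by the next term, which is then at least 2. *)
Lemma leq_sum_skip (a : nat -> nat) (n : nat) :
    (forall i, 0 < i < n -> 0 < a i \/ 1 < a i.+1) ->
  forall m, m <= n -> m <= \sum_(1 <= i < m.+1) a i + (a m == 0).
Proof.
move=> skip; elim=> [//|m IHm] ltmn; have := IHm (ltnW ltmn).
rewrite (big_nat_recr m.+1) //=; case: m {IHm} ltmn => [|m] ltmn.
  by rewrite big_geq //; case: (a 1).
by have [|] := skip m.+1 ltmn; case: eqP; case: eqP; lia.
Qed.

Lemma sum_pairs_le (a : nat -> nat) (m n : nat) :
    (forall i, m <= i -> i.+1 < m + 2 * n -> a i + a i.+1 <= 1) ->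
  \sum_(m <= i < m + 2 * n) a i <= n.
Proof.
elim: n => [|n IHn] pair; first by rewrite big_geq // muln0 addn0.
have -> : m + 2 * n.+1 = (m + 2 * n).+2 by lia.
rewrite !big_nat_recr /=; try lia.
have := IHn (fun i lemi lti => pair i lemi ltac:(lia)).
have := pair (m + 2 * n); lia.
Qed.

Lemma sum_le_indicator (n : nat) : \sum_(1 <= i < n.+1) (i <= n) = n.
Proof.
rewrite (eq_big_nat _ _ (F2 := fun=> 1)) => [|i /andP[_ ltin]].
  by rewrite sum_nat_const_nat muln1 subn1.
by rewrite -ltnS ltin.
Qed.

Lemma sum_even (n : nat) : \sum_(1 <= i < (2 * n).+1) ~~ odd i = n.
Proof.
elim: n => [|n IHn]; first by rewrite big_geq.
have -> : 2 * n.+1 = (2 * n).+2 by lia.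
rewrite big_nat_recr // big_nat_recr //= IHn; lia.
Qed.

(** * Layers *)

Definition layer (m s : nat) (S : {set 'I_m * 'I_s}) (i : nat) :=
  [set p in S | p.1 == i :> nat].

Lemma card_layers (m s : nat) (S : {set 'I_m * 'I_s}) :
  #|S| = \sum_(0 <= i < m) #|layer S i|.
Proof.
rewrite -sum1_card (partition_big (fun p => p.1) predT) //= big_mkord.
by apply: eq_bigr => i _; rewrite -sum1_card; apply: eq_bigl => p; rewrite inE.
Qed.

Lemma layer_setX (m s i : nat) (ltim : i < m) :
  layer [set: 'I_m * 'I_s] i = setX [set Ordinal ltim] [set: 'I_s].
Proof. by apply/setP => -[u v]; rewrite !inE andbT -val_eqE. Qed.

Lemma card_layer_setT (m s i : nat) :
  i < m -> #|layer [set: 'I_m * 'I_s] i| = s.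
Proof. by move=> ltim; rewrite layer_setX cardsX cards1 cardsT card_ord mul1n. Qed.

Lemma card_layer_full (m s i : nat) (S : {set 'I_m * 'I_s}) :
  i < m -> (forall p : 'I_m * 'I_s, p.1 = i :> nat -> p \in S) -> #|layer S i| = s.
Proof.
move=> ltim fullS; rewrite -[RHS](card_layer_setT s ltim).
congr #|pred_of_set _|; apply/setP => p; rewrite !inE /=.
by case: eqP => [/fullS ->|_]; rewrite ?andbF.
Qed.

Lemma card_layer_le (m s i : nat) (S : {set 'I_m * 'I_s}) :
  i < m -> #|layer S i| <= s.
Proof.
move=> ltim; rewrite -[leqRHS](card_layer_setT s ltim); apply: subset_leq_card.
by apply/subsetP => p; rewrite !inE => /andP[].
Qed.

(** The smallest dominating set and the largest packing both have this shape:
    they differ only in the choice of the layers [c]. *)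
Definition comb (m s : nat) (c : pred nat) : {set 'I_m * 'I_s} :=
  [set p : 'I_m * 'I_s | (p.1 == 0 :> nat) || c p.1 && (p.2 == 0 :> nat)].

Lemma card_comb (m s : nat) (c : pred nat) :
  0 < s -> #|comb m.+1 s c| = s + \sum_(1 <= i < m.+1) c i.
Proof.
move=> s_gt0; rewrite card_layers big_nat_recl // big_add1 /=; congr (_ + _).
  by apply: card_layer_full => // p p0; rewrite inE p0.
apply: eq_big_nat => i /andP[_ ltim]; have lt1 : i.+1 < m.+1 by [].
have [ci|nci] := boolP (c i.+1).
  rewrite -[RHS](cards1 (Ordinal lt1, Ordinal s_gt0)); congr #|pred_of_set _|.
  apply/setP => -[u v]; rewrite !inE xpair_eqE -!val_eqE /=.
  by case: (nat_of_ord u =P i.+1) => [->|]; rewrite ?andbF // ci andbT.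
apply/eqP; rewrite cards_eq0; apply/eqP/setP => p; rewrite !inE.
by case: (nat_of_ord p.1 =P i.+1) => [->|]; rewrite ?andbF // (negbTE nci).
Qed.

(** * Extremal sets *)

Lemma domination_numberP (V : finType) (D : rel V) (S : {set V}) :
    dominating D S -> (forall T, dominating D T -> #|S| <= #|T|) ->
  domination_number D = #|S|.
Proof.
move=> domS minS; rewrite /domination_number.
have domT : dominating D [set: V] by apply/forallP => v; rewrite inE.
case: arg_minnP => // T domT' minT; apply/eqP.
by rewrite eqn_leq minT // minS.
Qed.

Lemma packing_numberP (V : finType) (D : rel V) (P : {set V}) :
    packing D P -> (forall Q, packing D Q -> #|Q| <= #|P|) ->
  packing_number D = #|P|.
Proof.
move=> packP maxP; apply/eqP; rewrite eqn_leq; apply/andP; split.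
  exact/bigmax_leqP.
by rewrite /packing_number (leq_bigmax_cond P packP).
Qed.

(** * Domination *)

Section Layered.

Variables (k s : nat).
Hypotheses (k_ge2 : 2 <= k) (s_ge2 : 2 <= s).

Local Notation D := (@Xf_arc k s).
Implicit Types S P : {set 'I_(2 * k).+1 * 'I_s}.

Lemma dominatingP S :
  reflect (forall v, v \notin S -> exists2 u, u \in S & D u v) (dominating D S).
Proof.
apply: (iffP forallP) => domS v.
  by have /implyP := domS v => /[apply] /exists_inP.
by apply/implyP => /domS ?; apply/exists_inP.
Qed.

Lemma dominating_source S : dominating D S -> #|layer S 0| = s.
Proof.
move=> /dominatingP domS; apply: card_layer_full => // p p0.
by apply/negPn/negP => /domS[u _]; rewrite /Xf_arc p0; lia.
Qed.

(** L_(i+1) can only be dominated from L_i, as the arcs that skip layers all end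
    in L_(2k). *)
Lemma dominating_skip S i :
  dominating D S -> 0 < i < 2 * k - 1 -> 0 < #|layer S i| \/ 1 < #|layer S i.+1|.
Proof.
move=> /dominatingP domS lti; have [|_] := posnP #|layer S i|; last by left.
move=> /eqP; rewrite cards_eq0 => /eqP Si0; right.
rewrite card_layer_full //; first by lia.
move=> p pi; apply/negPn/negP => /domS[u uS]; rewrite /Xf_arc pi.
case/orP => [ui|]; last by lia.
have : u \in layer S i by rewrite inE uS eq_sym -eqSS.
by rewrite Si0 inE.
Qed.

Lemma dominating_card_ge S : dominating D S -> s + (2 * k - 2) <= #|S|.
Proof.
move=> domS; rewrite card_layers big_ltn // dominating_source // leq_add2l.
have := leq_sum_skip (fun i => dominating_skip domS (i := i)) (leqnn _).
rewrite (_ : (2 * k - 1).+1 = 2 * k); last by lia.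
by rewrite [\sum_(1 <= i < (2 * k).+1) _]big_nat_recr /=; lia.
Qed.

Lemma dominating_comb : dominating D (comb _ s (fun i => i <= 2 * k - 2)).
Proof.
apply/dominatingP => -[i a]; rewrite inE negb_or /= => /andP[i0 _].
(* [j] is the layer of the dominator: the preceding one, except for L_(2k). *)
pose j := if i == 2 * k :> nat then 0 else i.-1.
have ltj : j < (2 * k).+1 by rewrite /j; have := ltn_ord i; case: ifP; lia.
have s_gt0 : 0 < s by lia.
exists (Ordinal ltj, Ordinal s_gt0).
  by rewrite inE /= eqxx /j; have := ltn_ord i; case: ifP; lia.
by rewrite /Xf_arc /= /j; case: ifP; lia.
Qed.

Lemma domination_Xf : domination_number D = s + (2 * k - 2).
Proof.
have card_S : #|comb (2 * k).+1 s (fun i => i <= 2 * k - 2)| = s + (2 * k - 2).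
  rewrite card_comb; last by lia.
  congr (_ + _); rewrite -[RHS]sum_le_indicator.
  rewrite (big_cat_nat (n := (2 * k - 2).+1)) //=; last by lia.
  rewrite [X in _ + X]big_nat_cond [X in _ + X]big1 ?addn0 //.
  by move=> i; lia.
rewrite -card_S; apply: domination_numberP; first exact: dominating_comb.
by move=> T /dominating_card_ge; rewrite card_S.
Qed.

(** * Packing *)

Lemma packingP P :
  reflect {in P &, forall x y, ~~ D x y /\
             (x != y -> forall v, ~~ (D v x && D v y))}
          (packing D P).
Proof.
apply: (iffP forall_inP) => packP x.
  move=> y xP yP; have /forall_inP/(_ y yP)/andP[Dxy /implyP nov] := packP x xP.
  by split=> // /nov /existsPn.
move=> xP; apply/forall_inP => y yP; have [-> nov] := packP x y xP yP.
by apply/implyP => /nov ?; apply/existsPn.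
Qed.

Lemma packing_layers2 P i :
  packing D P -> 0 < i < 2 * k -> #|layer P i| + #|layer P i.+1| <= 1.
Proof.
move=> /packingP packP lti.
have disj : layer P i :&: layer P i.+1 = set0.
  by apply/setP => -[j a]; rewrite !inE /=; lia.
rewrite -cardsUI disj cards0 addn0; apply/card_le1_eqP => -[j a] [l b].
rewrite !inE -!andb_orr /= => /andP[xP xi] /andP[yP yi].
apply/esym/eqP/negPn/negP => neqxy.
have [nDxy /(_ neqxy) nov] := packP _ _ xP yP.
have [nDyx _] := packP _ _ yP xP.
(* Any vertex of the preceding layer dominates both, if their layers agree. *)
have ltj : j.-1 < (2 * k).+1 by have := ltn_ord j; lia.
have := nov (Ordinal ltj, a); move: nDxy nDyx; rewrite /Xf_arc /=; lia.
Qed.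

(** A source vertex is adjacent to all of L_1 and L_(2k). *)
Lemma packing_source P i :
    packing D P -> 0 < #|layer P 0| -> i = 1 \/ i = 2 * k ->
  #|layer P i| = 0.
Proof.
move=> /packingP packP /card_gt0P[[j a]].
rewrite inE /= => /andP[xP j0] i1.
apply/eqP; rewrite cards_eq0; apply/eqP/setP => -[l b]; rewrite !inE /=.
apply/negP => /andP[yP yi]; have [+ _] := packP _ _ xP yP.
by rewrite /Xf_arc /=; lia.
Qed.

Lemma packing_card_le P : packing D P -> #|P| <= s + (k - 1).
Proof.
move=> packP; rewrite card_layers big_ltn //.
have [P0|P0] := posnP #|layer P 0|.
  have := @sum_pairs_le (fun i => #|layer P i|) 1 k.
  rewrite add1n P0 => /(_ _)/leq_trans; apply; last by lia.
  by move=> i i1 i2; apply: packing_layers2 => //; lia.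
apply: leq_add; first exact: card_layer_le.
rewrite big_ltn; last by lia.
rewrite big_nat_recr /=; last by lia.
have -> := packing_source packP P0 (or_introl (erefl 1)).
have -> := packing_source packP P0 (or_intror (erefl (2 * k))).
have := @sum_pairs_le (fun i => #|layer P i|) 2 (k - 1).
rewrite (_ : 2 + 2 * (k - 1) = 2 * k); last by lia.
rewrite add0n addn0; apply => i i1 i2.
by apply: packing_layers2 => //; lia.
Qed.

Lemma packing_comb :
  packing D (comb _ s (fun i => ~~ odd i && (i < 2 * k))).
Proof.
apply/packingP => -[i a] [j b]; rewrite !inE /= => xP yP.
split; first by rewrite /Xf_arc /=; lia.
by rewrite -pair_eqE /= -!val_eqE /= => neqxy [l c]; rewrite /Xf_arc /=; lia.
Qed.

Lemma packing_Xf : packing_number D = s + (k - 1).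
Proof.
have card_P : #|comb (2 * k).+1 s (fun i => ~~ odd i && (i < 2 * k))| = s + (k - 1).
  rewrite card_comb; last by lia.
  congr (_ + _); rewrite -[RHS]sum_even.
  rewrite (big_cat_nat (n := (2 * (k - 1)).+1)) //=; last by lia.
  rewrite [X in _ + X]big_nat_cond [X in _ + X]big1 ?addn0; last by move=> i; lia.
  by apply: eq_big_nat => i; lia.
rewrite -card_P; apply: packing_numberP; first exact: packing_comb.
by move=> Q /packing_card_le; rewrite card_P.
Qed.

End Layered.

Theorem theorem5p6 (k s : nat) (hk : 2 <= k) (hs : 2 <= s) :
  domination_number (Xf s hk) = s + 2 * k - 2 /\
  packing_number (Xf s hk) = s + k - 1.
Proof.
rewrite -addnBA; last by lia.
rewrite -addnBA; last by lia.
by split; [exact: domination_Xf | exact: packing_Xf].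
Qed.
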